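(* Let $(X,T)$ be a minimal Cantor system and $x_0\in X$. Then the following are equivalent: (1) $(X,T)$ is conjugate to an (infinite) rank-$1$ subshift. (2) There is a clopen subset $A$ of $X$ such that $(T,A)$ is generating and for all $n\in\mathbb{N}$ there is a $v\in\mathcal{F}$ satisfying: (a) $|v|\ge n$ and $\mathrm{Ret}_A(x_0)$ is built from $v$; and (b) for any $u\in\mathcal{F}$ such that $|u|\ge|v|$ and $\mathrm{Ret}_A(x_0)$ is built from $u$, there exists $u'\in\mathcal{F}$ such that $|u'|\le|u|+|v|$, $u'$ is built from $v$, and $u$ is an initial segment of $u'$.
   Context: A minimal Cantor system $(X,T)$ is a homeomorphism $T$ of a Cantor space $X$ (zero-dimensional, perfect, compact metrizable) all of whose orbits are dense. Conjugacy of $(X,T)$ and $(Y,S)$ means a homeomorphism $\varphi:X\to Y$ with $\varphi T=S\varphi$. For clopen $A\subseteq X$ and $x\in X$, $\mathrm{Ret}_A(x)=\{m\in\mathbb{Z}:T^mx\in A\}$, viewed as an element of $2^{\mathbb{Z}}=\{0,1\}^{\mathbb{Z}}$ via its characteristic function. $(T,A)$ is generating if the smallest Boolean algebra of subsets of $X$ containing $T^mA$ for all $m\in\mathbb{Z}$ contains all clopen subsets of $X$. $\sigma$ is the shift on $2^{\mathbb{Z}}$, $\sigma(x)(n)=x(n+1)$. $\mathcal{F}$ is the set of all finite $0,1$-words that begin and end with $0$; $|v|$ is the length of $v$; an initial segment is a prefix. Let $\mathcal{Z}$ be the set of $x\in 2^{\mathbb{Z}}$ such that $x(m)=0$ for infinitely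 many $m>0$ and for infinitely many $m<0$. For $v\in\mathcal{F}$, a bi-infinite word $x\in\mathcal{Z}$ is built from $v$ if for some $n\in\mathbb{Z}$ and some bi-infinite sequence $(\dots,s_{-1},s_0,s_1,\dots)$ of nonnegative integers, $\sigma^n(x)=\cdots v1^{s_{-2}}v1^{s_{-1}}v1^{s_0}\cdot v1^{s_1}v1^{s_2}\cdots$ (that ''$x$ is built from $v$'' includes $x\in\mathcal{Z}$). A finite word $u\in\mathcal{F}$ is built from $v\in\mathcal{F}$ if $u=v1^{s_1}v\cdots v1^{s_k}v$ for some $k\ge1$ and nonnegative integers $s_1,\dots,s_k$. Rank-$1$ subshifts: Given integers $r_n>1$ ($n\ge0$) and nonnegative integers $s_{n,i}$ ($n\ge0$, $1\le i<r_n$), define $v_0=0$ and $v_{n+1}=v_n1^{s_{n,1}}v_n\cdots v_n1^{s_{n,r_n-1}}v_n$ (with $r_n$ copies of $v_n$). The infinite word $V=\lim_nv_n$ is a rank-$1$ word, and $X_V=\{x\in2^{\mathbb{Z}}:$ every finite subword of $x$ is a subword of $V\}$, with $\sigma$, is a rank-$1$ subshift. *)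

(* Defs.v *)
From HB Require Import structures.
From mathcomp Require Import all_boot all_order all_algebra.
From mathcomp Require Import all_classical reals topology cantor.
From mathcomp Require Import measurable_structure.

Set Implicit Arguments.
Unset Strict Implicit.
Unset Printing Implicit Defensive.

Import Order.TTheory GRing.Theory Num.Theory.
Local Open Scope classical_set_scope.
Local Open Scope ring_scope.

Record homeo (X Y : topologicalType) := Homeo {
  homeo_fun :> X -> Y;
  homeo_inv : Y -> X;
  homeo_funK : cancel homeo_fun homeo_inv;
  homeo_invK : cancel homeo_inv homeo_fun;
  homeo_fun_cont : continuous homeo_fun;
  homeo_inv_cont : continuous homeo_inv }.

(* The power T^m, for m of either sign; recall that Negz n is - n.+1. *)
Definition zpow (X : topologicalType) (T : homeo X X) (m : int) : X -> X :=
  match m with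
  | Posz n => iter n T
  | Negz n => iter n.+1 (homeo_inv T)
  end.

Definition conjugate (X Y : topologicalType) (T : X -> X) (S : Y -> Y) : Prop :=
  exists phi : homeo X Y, forall x, phi (T x) = S (phi x).

(* [cantor_like] asks for perfect, compact, Hausdorff and zero-dimensional;
   metrizability is carried by the type, and the chosen metric is not used
   otherwise. *)
Definition minimal_cantor_system (R : realType) (X : metricType R)
    (T : homeo X X) : Prop :=
  cantor_like X /\ forall x : X, dense (range (fun m : int => zpow T m x)).

Definition boolean_algebra_of_sets (X : Type) (B : set (set X)) : Prop :=
  [/\ B setT, setU_closed B & setC_closed B].

Definition generating (X : topologicalType) (T : homeo X X) (A : set X) : Prop :=
  @clopen X `<=` smallest (@boolean_algebra_of_sets X)
                          (range (fun m : int => zpow T m @` A)).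

(* The letters 0 and 1 are false and true; 2^Z has the product topology. *)
Notation bin_seq := {ptws int -> bool}.

Definition Ret (X : topologicalType) (T : homeo X X) (A : set X) (x : X) :
  bin_seq := fun m : int => zpow T m x \in A.

(* The n-th power of the shift sigma = shift 1. *)
Definition shift (n : int) (x : bin_seq) : bin_seq := fun k : int => x (k + n).

(* The finite subword x(i) x(i+1) ... x(i+k-1). *)
Definition word_at (x : bin_seq) (i : int) (k : nat) : seq bool :=
  mkseq (fun j => x (i + j%:Z)) k.

(* The default letter true excludes the empty word. *)
Definition calF (v : seq bool) : Prop :=
  head true v = false /\ last true v = false.

Definition calZ (x : bin_seq) : Prop :=
  infinite_set [set m : int | 0 < m /\ x m = false] /\
  infinite_set [set m : int | m < 0 /\ x m = false].

(* v 1^{s_1} v 1^{s_2} ... v 1^{s_k} v for ss = [s_1; ...; s_k] *)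
Definition spaced (v : seq bool) (ss : seq nat) : seq bool :=
  v ++ flatten [seq nseq s true ++ v | s <- ss].

Definition word_built_from (u v : seq bool) : Prop :=
  exists2 ss : seq nat, (0 < size ss)%N & u = spaced v ss.

(* y = ... v 1^{s_{-1}} v 1^{s_0} . v 1^{s_1} v 1^{s_2} ..., where the dot
   precedes the coordinate 0 and p i is the position at which the block
   v 1^{s_i} starts. *)
Definition is_biconcat (v : seq bool) (s : int -> nat) (y : bin_seq) : Prop :=
  exists p : int -> int, p 1 = 0 /\
    forall i : int, p (i + 1) = p i + (size v + s i)%N%:Z /\
      word_at y (p i) (size v + s i) = v ++ nseq (s i) true.

Definition built_from (x : bin_seq) (v : seq bool) : Prop :=
  calZ x /\ exists (n : int) (s : int -> nat), is_biconcat v s (shift n x).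

(* The words v_n; there are r n copies of v_n in v_{n+1}, separated by the
   spacers s n 1, ..., s n (r n - 1). *)
Fixpoint rank1_approx (r : nat -> nat) (s : nat -> nat -> nat) (n : nat) :
    seq bool :=
  if n is m.+1 then spaced (rank1_approx r s m) (map (s m) (iota 1 (r m).-1))
  else [:: false].

(* The v_n are prefixes of one another and of unbounded length, so V = lim v_n
   means that every v_n is a prefix of V. *)
Definition rank1_word (V : nat -> bool) : Prop :=
  exists (r : nat -> nat) (s : nat -> nat -> nat),
    (forall n, (1 < r n)%N) /\
    forall n, mkseq V (size (rank1_approx r s n)) = rank1_approx r s n.

Definition subword_of (V : nat -> bool) (w : seq bool) : Prop :=
  exists p : nat, w = mkseq (fun j => V (p + j)%N) (size w).

Definition rank1_subshift (V : nat -> bool) : set bin_seq :=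
  [set x | forall (i : int) (k : nat), subword_of V (word_at x i k)].

Lemma shift_rank1_subshift V (x : bin_seq) :
  rank1_subshift V x -> rank1_subshift V (shift 1 x).
Proof.
move=> Vx i k; have := Vx (i + 1) k; congr (subword_of V _).
by apply: eq_mkseq => j; rewrite /shift addrAC.
Qed.

Definition rank1_shift (V : nat -> bool) (x : rank1_subshift V) :
    rank1_subshift V :=
  exist _ (shift 1 (set_val x)) (mem_set (shift_rank1_subshift (set_valP x))).

(* Main.v *)
(* Number the zeros of x = Ret_A(x0) by the integers.  That x is built from a
   word v with r zeros means that, off one coset of r Z (the gaps between
   consecutive copies of v), the sequence of gaps between zeros is r-periodic.
   If x is built from two words with r and q zeros, the two cosets meet, since
   otherwise the gaps, hence x, would be periodic, which minimality on a perfect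
   space forbids.  Hence some copies of the two words start at the same zero,
   which makes (b) automatic, and off the common coset of lcm(r, q) Z the gaps
   are lcm(r, q)-periodic, so x is also built from a word with lcm(r, q) zeros
   that is built from both.  Iterating the lcm turns the words provided by (a)
   into a rank-1 sequence v_n; by minimality the subwords of x are those of
   lim v_n, and x |-> Ret_A(x) is the conjugacy.  Conversely, in a rank-1 subshift
   take A = {x : x(0) = 1}: the fixed point 1^Z is excluded by minimality, and a
   pigeonhole argument on windows shows that every point is built from every
   v_n. *)

Require Import Defs.
From HB Require Import structures.
From mathcomp Require Import all_boot all_order all_algebra zify.
From mathcomp Require Import all_classical reals topology cantor.

Set Implicit Arguments.
Unset Strict Implicit.
Unset Printing Implicit Defensive.

Import Order.TTheory GRing.Theory Num.Theory.
Local Open Scope classical_set_scope.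
Local Open Scope ring_scope.

(** * Numbering the zeros of a bi-infinite word *)

(** The condition is local. An integer-valued map that grows by at least one at each step is
    unbounded in both directions, so [z] reaches every zero of [x]. *)
Definition zero_enum (x : int -> bool) (z : int -> int) : Prop :=
  forall i, [/\ z i < z (i + 1), x (z i) = false &
    forall m, z i < m -> m < z (i + 1) -> x m = true].

Lemma zero_enum_gap x z (zP : zero_enum x z) (i : int) (k : nat) :
  z i + k%:Z <= z (i + k%:Z).
Proof.
elim: k => [|k IHk]; first by rewrite !addr0.
have [] := zP (i + k%:Z); have -> : i + k%:Z + 1 = i + k.+1%:Z by lia.
lia.
Qed.

Lemma zero_enum_le x z (zP : zero_enum x z) (i j : int) :
  i <= j -> z i <= z j.
Proof.
move=> ij; have := zero_enum_gap zP i `|j - i|%N.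
have -> : i + `|j - i|%N%:Z = j by lia.
lia.
Qed.

Lemma zero_enum_lt x z (zP : zero_enum x z) (i j : int) :
  (z i < z j) = (i < j).
Proof.
apply/idP/idP => [|ij]; last first.
  have [+ _ _] := zP i; have : z (i + 1) <= z j by apply: zero_enum_le zP _ _ _; lia.
  lia.
by apply: contraLR; rewrite -!leNgt; exact: zero_enum_le zP _ _.
Qed.

Lemma zero_enum_inj x z (zP : zero_enum x z) : injective z.
Proof.
move=> i j zij; have := zero_enum_lt zP i j; have := zero_enum_lt zP j i.
rewrite zij ltxx; lia.
Qed.

Lemma zero_enum_cover x z (zP : zero_enum x z) (m : int) :
  exists i, z i <= m /\ m < z (i + 1).
Proof.
have [i0 zi0] : exists i0, z i0 <= m.
  (* Going back N zeros from [z 0] moves at least N places to the left. *)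
  pose N := absz (m - z 0)%R; exists (- N%:Z).
  have : z 0 - m <= N%:Z by rewrite /N; lia.
  clearbody N; move=> zN.
  have : z (- N%:Z) + N%:Z <= z 0.
    by have := zero_enum_gap zP (- N%:Z) N; rewrite addNr.
  lia.
have [n] : exists n : nat, m < z i0 + n%:Z by exists `|m - z i0|.+1%N; lia.
elim: n i0 zi0 => [|n IHn] i zi mn; first lia.
have [?|zi1] := ltP m (z (i + 1)); first by exists i.
apply: (IHn _ zi1); have [] := zP i; lia.
Qed.

Lemma zero_enum_surj x z (zP : zero_enum x z) (m : int) :
  x m = false -> exists i, z i = m.
Proof.
move=> xm; have [i [zim mzi]] := zero_enum_cover zP m; exists i.
have [_ _ /(_ m)] := zP i; rewrite xm => ones.
apply/eqP; rewrite eq_le zim /= leNgt; apply/negP => zm.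
by have := ones zm mzi.
Qed.

Lemma zero_enum_next x z (zP : zero_enum x z) (i m : int) :
    z i < m -> x m = false -> (forall n, z i < n -> n < m -> x n = true) ->
  z (i + 1) = m.
Proof.
move=> zim /(zero_enum_surj zP) [j zj] ones; subst m.
rewrite (zero_enum_lt zP) in zim; congr z.
apply/eqP; rewrite eq_le; apply/andP; split; first lia.
rewrite leNgt; apply/negP => ij.
have [zi1 _ _] := zP i; have [_ x1 _] := zP (i + 1).
by have := ones _ zi1; rewrite x1 (zero_enum_lt zP) => /(_ ij).
Qed.

Lemma eq_word_at (x y : bin_seq) (a b : int) (n : nat) :
  word_at x a n = word_at y b n <->
  forall m : int, 0 <= m -> m < n%:Z -> x (a + m) = y (b + m).
Proof.
split=> [e m m0 mn|e].
  have /= := congr1 (nth true ^~ `|m|%N) e.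
  rewrite !nth_mkseq; try lia.
  by rewrite gez0_abs.
apply/eq_in_map => k; rewrite mem_iota => kn; apply: e; lia.
Qed.

Lemma size_word_at x a n : size (word_at x a n) = n.
Proof. by rewrite size_mkseq. Qed.

(** Both enumerations advance together: as long as the next zero of [x] falls inside the common
    window, [y] has a zero at the same offset and only ones before it. *)
Lemma zero_enum_agree (x y : bin_seq) z t (zP : zero_enum x z)
    (tP : zero_enum y t) (i j : int) (n : nat) :
    word_at x (z i) n = word_at y (t j) n ->
  forall k : nat, z (i + k%:Z) < z i + n%:Z ->
    t (j + k%:Z) = t j + (z (i + k%:Z) - z i).
Proof.
move=> /eq_word_at e; elim=> [|k IHk] zn; first by rewrite !addr0; lia.
have [z1 _ xo] := zP (i + k%:Z); have [_ xz _] := zP (i + k.+1%:Z).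
have ge0 := zero_enum_gap zP i k.
have E u : u + k.+1%:Z = u + k%:Z + 1 by lia.
rewrite E in zn xz *; have tk := IHk (lt_trans z1 zn).
rewrite E; apply: (zero_enum_next tP); rewrite ?tk; first lia.
  rewrite -e; [|lia|lia].
  by rewrite -xz; congr x; lia.
move=> m m1 m2; have := e (m - t j); rewrite (addrC (t j)) subrK => <-; [|lia|lia].
apply: xo; lia.
Qed.

(** * Being built from a word, in terms of gaps *)

(* The unconstrained gaps, those preceding the zeros z (c + k r), contain the
   spacers; zero_word x z c r is then the block v. *)
Definition cyclic_gaps (z : int -> int) (c : int) (r : nat) : Prop :=
  forall i, ~~ (r%:Z %| i - c)%Z ->
    z (i + r%:Z) - z (i + r%:Z - 1) = z i - z (i - 1).

Definition zero_word (x : bin_seq) (z : int -> int) (c : int) (r : nat) :=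
  word_at x (z c) (absz (z (c + r%:Z - 1) - z c)%R).+1.

Lemma size_zero_word x z (zP : zero_enum x z) (c : int) r : (0 < r)%N ->
  (size (zero_word x z c r))%:Z = z (c + r%:Z - 1) - z c + 1.
Proof.
move=> r0; rewrite size_word_at; have : z c <= z (c + r%:Z - 1).
  by apply: (zero_enum_le zP); lia.
lia.
Qed.

Lemma dvdz_addM (r i k : int) : (r %| i + k * r)%Z = (r %| i)%Z.
Proof. by rewrite rpredDr // dvdz_mull. Qed.

Lemma cyclic_gaps_mul z (c : int) r : cyclic_gaps z c r ->
  forall i (k : int), ~~ (r%:Z %| i - c)%Z ->
    z (i + k * r%:Z) - z (i + k * r%:Z - 1) = z i - z (i - 1).
Proof.
move=> D i k ndvd.
have pos (n : nat) j : ~~ (r%:Z %| j - c)%Z ->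
    z (j + n%:Z * r%:Z) - z (j + n%:Z * r%:Z - 1) = z j - z (j - 1).
  elim: n j => [|n IHn] j nj; first by rewrite mul0r !addr0.
  have -> : j + n.+1%:Z * r%:Z = j + n%:Z * r%:Z + r%:Z by lia.
  rewrite D ?IHn //; have -> : j + n%:Z * r%:Z - c = j - c + n%:Z * r%:Z by lia.
  by rewrite dvdz_addM.
case: (intP k) => [|n|n]; first by rewrite mul0r !addr0.
  exact: pos.
(* A negative multiple is a positive one read from its other end. *)
rewrite -(pos n.+1 (i + - n.+1%:Z * r%:Z)).
  by have -> : i + - n.+1%:Z * r%:Z + n.+1%:Z * r%:Z = i by lia.
have -> : i + - n.+1%:Z * r%:Z - c = i - c + - n.+1%:Z * r%:Z by lia.
by rewrite dvdz_addM.
Qed.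

Lemma cyclic_gaps_shift z (c c' : int) r : (r%:Z %| c' - c)%Z ->
  cyclic_gaps z c r -> cyclic_gaps z c' r.
Proof.
move=> cc' D i ndvd; apply: D; apply: contra ndvd => ic.
have -> : i - c' = i - c - (c' - c) by lia.
exact: rpredB.
Qed.

(** From the first zero of a block to its last, only constrained gaps are crossed, so their partial
    sums are the same in every block. *)
Lemma cyclic_gaps_block z (c : int) r : cyclic_gaps z c r ->
  forall i, (r%:Z %| i - c)%Z -> forall l : nat, (l < r)%N ->
    z (i + l%:Z) - z i = z (c + l%:Z) - z c.
Proof.
move=> D i /dvdzP[k ik]; elim=> [|l IHl] lr; first by rewrite !addr0 !subrr.
have nd : ~~ (r%:Z %| c + l.+1%:Z - c)%Z.
  have -> : c + l.+1%:Z - c = l.+1%:Z by lia.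
  by rewrite dvdzE /= gtnNdvd.
have := cyclic_gaps_mul D k nd; have := IHl (ltnW lr).
have -> : c + l.+1%:Z + k * r%:Z = i + l.+1%:Z by lia.
have -> : i + l.+1%:Z - 1 = i + l%:Z by lia.
have -> : c + l.+1%:Z - 1 = c + l%:Z by lia.
lia.
Qed.

(** An index off the coset of the lcm is off the coset of [r] or of [q], and periodicity with that
    step passes to its multiples. *)
Lemma cyclic_gaps_lcm z (c : int) r q : cyclic_gaps z c r -> cyclic_gaps z c q ->
  cyclic_gaps z c (lcmn r q).
Proof.
move=> Dr Dq i; have [ri|ri] := boolP (r%:Z %| i - c)%Z; last first.
  move=> _; have /dvdnP[k ->] := dvdn_lcml r q.
  by rewrite PoszM; exact: (cyclic_gaps_mul Dr).
move=> nd; have qi : ~~ (q%:Z %| i - c)%Z.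
  apply: contra nd => qi; move: ri qi; rewrite !dvdzE /= => ri qi.
  by rewrite dvdn_lcm ri.
have /dvdnP[k ->] := dvdn_lcmr r q.
by rewrite PoszM; exact: (cyclic_gaps_mul Dq).
Qed.

(* If the two cosets of block starts were disjoint, every gap would repeat
   after r q zeros and x would be periodic. *)
Lemma cyclic_gaps_meet x z (zP : zero_enum x z) (c : int) r (c' : int) q :
    (forall d, 0 < d -> ~ forall m, x (m + d) = x m) ->
    (0 < r)%N -> (0 < q)%N -> cyclic_gaps z c r -> cyclic_gaps z c' q ->
  exists e, (r%:Z %| e - c)%Z && (q%:Z %| e - c')%Z.
Proof.
move=> aper r0 q0 Dr Dq; apply: contrapT => nomeet.
have per i : z (i + (r * q)%N%:Z) - z (i + (r * q)%N%:Z - 1) = z i - z (i - 1).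
  have [ri|ri] := boolP (r%:Z %| i - c)%Z.
    have qi : ~~ (q%:Z %| i - c')%Z.
      by apply/negP => qi; apply: nomeet; exists i; rewrite ri.
    by rewrite PoszM; exact: (cyclic_gaps_mul Dq).
  by rewrite mulnC PoszM; exact: (cyclic_gaps_mul Dr).
have rq0 : (0 < r * q)%N by rewrite muln_gt0 r0.
move: (r * q)%N rq0 per => N N0 per; pose d := z N%:Z - z 0.
(* The distance spanned by N consecutive gaps does not depend on where they start; this distance [d]
   will be a period of [x]. *)
have pern (n : nat) i : z (i + n%:Z + N%:Z) - z (i + n%:Z) = z (i + N%:Z) - z i.
  elim: n => [|n IHn]; first by rewrite addr0.
  have := per (i + n.+1%:Z).
  have -> : i + n.+1%:Z - 1 = i + n%:Z by lia.
  have -> : i + n.+1%:Z + N%:Z - 1 = i + n%:Z + N%:Z by lia.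
  lia.
have perd i : z (i + N%:Z) = z i + d.
  rewrite /d; have := pern `|i|%N 0; have := pern `|i|%N i.
  rewrite !add0r; have [i0|i0] := leP 0 i.
    rewrite gez0_abs //; lia.
  have -> : i + `|i|%N%:Z = 0 by lia.
  rewrite !add0r; lia.
have d0 : 0 < d by rewrite subr_gt0 (zero_enum_lt zP); lia.
apply: (aper d d0); clearbody d.
move=> m; have [i [zim mzi]] := zero_enum_cover zP m.
have [_ xi xio] := zP i; have [_ xN xNo] := zP (i + N%:Z).
have e : i + N%:Z + 1 = i + 1 + N%:Z by lia.
rewrite e !perd in xN xNo.
have [<-|zm] := eqVneq (z i) m; first by rewrite xi -xN.
rewrite (xio m) ?(xNo (m + d)) //; lia.
Qed.

(** Converse to [zero_enum_agree]: between consecutive zeros there are only ones, so the offsets of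
    the zeros determine the window. *)
Lemma zero_enum_window x y z t (zP : zero_enum x z) (tP : zero_enum y t)
    (i j : int) (k n : nat) :
    (forall l : nat, (l <= k)%N -> t (j + l%:Z) - t j = z (i + l%:Z) - z i) ->
    n%:Z = z (i + k%:Z) - z i + 1 ->
  word_at x (z i) n = word_at y (t j) n.
Proof.
move=> tz nE; apply/eq_word_at => m m0 mn.
have [e [zem mze]] := zero_enum_cover zP (z i + m).
have ie : i <= e.
  rewrite leNgt; apply/negP => ei; have : z (e + 1) <= z i.
    by apply: (zero_enum_le zP); lia.
  lia.
have ek : e <= i + k%:Z.
  rewrite leNgt -(zero_enum_lt zP); lia.
have [l el] : exists l : nat, e = i + l%:Z by exists `|e - i|%N; lia.
subst e; have tl : t (j + l%:Z) - t j = z (i + l%:Z) - z i by apply: tz; lia.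
have [_ xl xlo] := zP (i + l%:Z); have [_ yl ylo] := tP (j + l%:Z).
have [zm|zm] := eqVneq (z (i + l%:Z)) (z i + m).
  by rewrite -zm xl -yl; congr y; lia.
have [lk|lk] := eqVneq l k; first by subst l; lia.
rewrite (xlo (z i + m)) ?(ylo (t j + m)) //; [lia| |lia].
have -> : j + l%:Z + 1 = j + l.+1%:Z by lia.
have : t (j + l.+1%:Z) - t j = z (i + l.+1%:Z) - z i by apply: tz; lia.
move: mze; have -> : i + l%:Z + 1 = i + l.+1%:Z by lia.
lia.
Qed.

Lemma cyclic_gaps_copy x z (zP : zero_enum x z) (c : int) r : (0 < r)%N ->
    cyclic_gaps z c r -> forall i, (r%:Z %| i - c)%Z ->
  zero_word x z i r = zero_word x z c r.
Proof.
move=> r0 D i ic; have E u : u + r%:Z - 1 = u + r.-1%:Z by lia.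
have B := cyclic_gaps_block D ic; rewrite /zero_word !E B; last by lia.
symmetry; apply: (zero_enum_window zP zP (k := r.-1)) => [l lr|].
  by apply: B; lia.
have : z c <= z (c + r.-1%:Z) by apply: (zero_enum_le zP); lia.
lia.
Qed.

(** Two copies of [v] that start at zeros have their zeros at the same offsets, which equates all
    gaps inside them. Only the gap in front of a copy stays free. *)
Lemma cyclic_gaps_of_copies x z (zP : zero_enum x z) (c : int) r v : (0 < r)%N ->
    (size v)%:Z = z (c + r%:Z - 1) - z c + 1 ->
    (forall k : int, word_at x (z (c + k * r%:Z)) (size v) = v) ->
  cyclic_gaps z c r /\ v = zero_word x z c r.
Proof.
move=> r0 sv wv; split; last first.
  rewrite -[LHS](wv 0) mul0r addr0 /zero_word; congr (word_at _ _ _).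
  have : z c <= z (c + r%:Z - 1) by apply: (zero_enum_le zP); lia.
  lia.
have B (k : int) (l : nat) : (l < r)%N ->
    z (c + k * r%:Z + l%:Z) - z (c + k * r%:Z) = z (c + l%:Z) - z c.
  move=> lr; rewrite (zero_enum_agree zP zP (i := c) (n := size v)) //.
  - lia.
  - by rewrite wv -[RHS](wv 0) mul0r addr0.
  have : z (c + l%:Z) <= z (c + r%:Z - 1) by apply: (zero_enum_le zP); lia.
  lia.
(* Zero [i] is number [l] of copy [k]. Off the coset [l] is positive, so zero [i - 1] belongs to the
   same copy. *)
move=> i nd; pose k := ((i - c) %/ r%:Z)%Z; pose l := `|((i - c) %% r%:Z)%Z|%N.
have iE : i = c + k * r%:Z + l%:Z.
  rewrite /k /l; have := divz_eq (i - c) r%:Z; have := modz_ge0 (i - c) (d := r%:Z).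
  lia.
have l0 : (0 < l)%N.
  rewrite lt0n; apply: contra nd => /eqP le0.
  have -> : i - c = 0 + k * r%:Z by lia.
  by rewrite dvdz_addM dvdz0.
have lr : (l < r)%N.
  rewrite /l; have := modz_ge0 (i - c) (d := r%:Z).
  have := @ltz_pmod (i - c) r%:Z; lia.
have := B k _ lr; have := B k l.-1; have := B (k + 1) _ lr; have := B (k + 1) l.-1.
have -> : c + (k + 1) * r%:Z + l%:Z = i + r%:Z by lia.
have -> : c + (k + 1) * r%:Z + l.-1%:Z = i + r%:Z - 1 by lia.
have -> : c + k * r%:Z + l.-1%:Z = i - 1 by lia.
rewrite -iE; lia.
Qed.

(** * Blocks as words: translation between concatenations and gaps *)

Lemma word_at_cat (x : bin_seq) a (n m : nat) :
  word_at x a (n + m) = word_at x a n ++ word_at x (a + n%:Z) m.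
Proof.
rewrite /word_at /mkseq iotaD map_cat; congr (_ ++ _).
rewrite add0n -{1}[n]addn0 iotaDl -map_comp; apply: eq_map => k /=.
by congr x; lia.
Qed.

Lemma word_at_ones (x : bin_seq) a (n : nat) :
    (forall m : int, a <= m -> m < a + n%:Z -> x m = true) ->
  word_at x a n = nseq n true.
Proof.
move=> ones; apply: (@eq_from_nth _ true); rewrite size_word_at ?size_nseq //.
move=> i ni; rewrite nth_mkseq // nth_nseq ni ones //; lia.
Qed.

Lemma calF_gt0 v : calF v -> (0 < size v)%N.
Proof. by case: v => // -[]. Qed.

Lemma calF_zero_word x z (zP : zero_enum x z) (c : int) r : (0 < r)%N ->
  calF (zero_word x z c r).
Proof.
move=> r0; have sz := size_zero_word zP c r0; split.
  by rewrite -nth0 /zero_word nth_mkseq // addr0; have [] := zP c.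
have zc : z c <= z (c + r%:Z - 1) by apply: (zero_enum_le zP); lia.
rewrite -nth_last nth_mkseq; last by rewrite size_word_at; lia.
have [_ + _] := zP (c + r%:Z - 1); apply: etrans.
by congr x; lia.
Qed.

Lemma zero_wordE x z (c : int) r :
  zero_word x z c r = word_at x (z c) (size (zero_word x z c r)).
Proof. by rewrite size_word_at. Qed.

Lemma prefix_zero_word x z (zP : zero_enum x z) (c : int) r q :
  (0 < r)%N -> (r <= q)%N -> prefix (zero_word x z c r) (zero_word x z c q).
Proof.
move=> r0 rq; have sr := size_zero_word zP c r0.
have sq := size_zero_word zP c (leq_trans r0 rq).
have le : z (c + r%:Z - 1) <= z (c + q%:Z - 1) by apply: (zero_enum_le zP); lia.
rewrite [X in prefix _ X]zero_wordE.
have -> : size (zero_word x z c q) =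
    (size (zero_word x z c r) +
      (size (zero_word x z c q) - size (zero_word x z c r)))%N by lia.
by rewrite word_at_cat -zero_wordE; exact: prefix_prefix.
Qed.

Lemma spaced_rcons v ss s :
  spaced v (rcons ss s) = spaced v ss ++ nseq s true ++ v.
Proof. by rewrite /spaced map_rcons flatten_rcons !catA. Qed.

(** Each further block appends the ones of a free gap and then the base word, because all blocks
    read the same. *)
Lemma zero_word_spaced x z (zP : zero_enum x z) (c : int) r k :
    (0 < r)%N -> cyclic_gaps z c r ->
  exists2 ss, size ss = k &
    zero_word x z c (k.+1 * r) = spaced (zero_word x z c r) ss.
Proof.
move=> r0 D; elim: k => [|k [ss sk IHk]].
  by exists [::] => //; rewrite mul1n /spaced cats0.
pose i := c + (k.+1 * r)%N%:Z.
have kr0 : (0 < k.+1 * r)%N by rewrite muln_gt0.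
have kr0' : (0 < k.+2 * r)%N by rewrite muln_gt0.
have iE : i - 1 + 1 = i by lia.
(* The number of ones between the last zero of one block and the first zero of the next. *)
pose s := absz (z i - z (i - 1) - 1)%R.
have sE : s%:Z = z i - z (i - 1) - 1.
  by have [] := zP (i - 1); rewrite iE /s; lia.
exists (rcons ss s); first by rewrite size_rcons sk.
have S1 := size_zero_word zP c kr0; have S2 := size_zero_word zP i r0.
have S3 := size_zero_word zP c kr0'.
rewrite -/i in S1; have e : c + (k.+2 * r)%N%:Z - 1 = i + r%:Z - 1 by rewrite /i; lia.
rewrite e in S3.
have SS : size (zero_word x z c (k.+2 * r)) =
   (size (zero_word x z c (k.+1 * r)) + (s + size (zero_word x z i r)))%N by lia.
rewrite spaced_rcons -IHk -(cyclic_gaps_copy zP r0 D (i := i)); last first.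
  have -> : i - c = 0 + k.+1%:Z * r%:Z by rewrite /i; lia.
  by rewrite dvdz_addM dvdz0.
rewrite [LHS]zero_wordE SS.
rewrite !word_at_cat; congr (_ ++ _); first by rewrite -zero_wordE.
congr (_ ++ _).
  apply: word_at_ones => m m1 m2; have [_ _ ones] := zP (i - 1).
  by apply: ones; rewrite ?iE; lia.
have -> : z c + (size (zero_word x z c (k.+1 * r)))%:Z + s%:Z = z i by lia.
by rewrite -zero_wordE.
Qed.

Lemma int_ind_pred (P : int -> Prop) (a : int) :
    P a -> (forall i, P i -> P (i + 1)) -> (forall i, P (i + 1) -> P i) ->
  forall i, P i.
Proof.
move=> Pa up dn i.
have Pup (n : nat) : P (a + n%:Z).
  elim: n => [|n IHn]; first by rewrite addr0.
  have -> : a + n.+1%:Z = a + n%:Z + 1 by lia.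
  exact: up.
have Pdn (n : nat) : P (a - n%:Z).
  elim: n => [|n IHn]; first by rewrite subr0.
  apply: dn; have -> : a - n.+1%:Z + 1 = a - n%:Z by lia.
  exact: IHn.
have [ia|ai] := leP a i.
  have [n ->] : exists n : nat, i = a + n%:Z by exists `|i - a|%N; lia.
  exact: Pup.
have [n ->] : exists n : nat, i = a - n%:Z by exists `|i - a|%N; lia.
exact: Pdn.
Qed.

(** As [v] begins and ends with a zero, every copy starts and ends at a zero of [x], and only spacer
    ones lie between two copies. Hence the copies start exactly once every [r] zeros, where [r] is
    the number of zeros of [v]. *)
Lemma biconcat_gaps (x : bin_seq) z (zP : zero_enum x z) v n s :
    calF v -> is_biconcat v s (shift n x) ->
  exists (c : int) (r : nat),
    [/\ (0 < r)%N, cyclic_gaps z c r & v = zero_word x z c r].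
Proof.
move=> Fv [p0 [_ pP]]; pose p (i : int) : int := p0 i + n.
have v0 := calF_gt0 Fv.
have pS (i : int) : p (i + 1) = p i + (size v)%:Z + (s i)%:Z.
  by rewrite /p; have [-> _] := pP i; lia.
have pW i : word_at x (p i) (size v) = v /\
    word_at x (p i + (size v)%:Z) (s i) = nseq (s i) true.
  have [_] := pP i; have -> : word_at (shift n x) (p0 i) (size v + s i)
      = word_at x (p i) (size v + s i).
    by apply/eq_word_at => m _ _; rewrite /shift /p; congr x; lia.
  rewrite word_at_cat => /eqP; rewrite eqseq_cat ?size_word_at //.
  by case/andP=> /eqP -> /eqP ->.
have xv i (m : int) : 0 <= m -> m < (size v)%:Z -> x (p i + m) = nth true v `|m|%N.
  move=> m0 mv; have [<- _] := pW i; rewrite nth_mkseq; last by lia.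
  by congr x; lia.
have xp i : x (p i) = false.
  by rewrite -[p i]addr0 xv //; case: Fv; rewrite nth0.
have xl i : x (p i + ((size v)%:Z - 1)) = false.
  rewrite xv; [|lia|lia]; have -> : absz ((size v)%:Z - 1)%R = (size v).-1 by lia.
  by rewrite nth_last; case: Fv.
have [c pc] := zero_enum_surj zP (xp 1).
have [d pd] := zero_enum_surj zP (xl 1).
have cd : c <= d by rewrite leNgt -(zero_enum_lt zP); lia.
(* The copy at [p 1] runs from zero [c] to zero [d], so [v] has [r.+1] zeros. *)
have [r rE] : exists r : nat, d = c + r.+1%:Z - 1 by exists `|d - c|%N; lia.
subst d; have step i e : p i = z e -> p (i + 1) = z (e + r.+1%:Z).
  move=> pe.
  have ze : z (e + r%:Z) = z e + (size v)%:Z - 1.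
    have -> := zero_enum_agree zP zP (i := c) (n := size v) _ (k := r).
    - have -> : c + r%:Z = c + r.+1%:Z - 1 by lia.
      lia.
    - by rewrite -pe pc; have [-> _] := pW 1; have [-> _] := pW i.
    - have -> : c + r%:Z = c + r.+1%:Z - 1 by lia.
      lia.
  have -> : e + r.+1%:Z = e + r%:Z + 1 by lia.
  symmetry; apply: (zero_enum_next zP) => [||m m1 m2]; rewrite ?pS ?ze; first lia.
    by rewrite -pS.
  have [_ ones] := pW i; pose l := absz (m - (p i + (size v)%:Z))%R.
  rewrite pS in m2.
  have /= := congr1 (nth true ^~ l) ones; rewrite nth_nseq nth_mkseq.
    2: by rewrite /l; lia.
  rewrite if_same => <-; congr x; rewrite /l; lia.
exists c, r.+1; split => //; last first.
  rewrite -[LHS](proj1 (pW 1)) -pc /zero_word; congr (word_at _ _ _); lia.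
have pk k : p (k + 1) = z (c + k * r.+1%:Z).
  apply: (int_ind_pred (P := fun k => p (k + 1) = z (c + k * r.+1%:Z)) (a := 0)).
  - by rewrite mul0r addr0 -pc.
  - by move=> i /step ->; congr z; lia.
  (* Backwards: the previous copy starts at some zero [e]; [step] applied there and the injectivity
     of [z] determine [e]. *)
  move=> i; have [e ze] := zero_enum_surj zP (xp (i + 1)).
  rewrite (step _ _ (esym ze)) => /(zero_enum_inj zP) ez.
  by rewrite -ze; congr z; lia.
have sv : (size v)%:Z = z (c + r.+1%:Z - 1) - z c + 1 by lia.
have [k|//] := cyclic_gaps_of_copies zP (ltn0Sn r) sv.
by rewrite -pk; have [] := pW (k + 1).
Qed.

(** Converse to [biconcat_gaps]: the free gaps supply the spacers. *)
Lemma gaps_built_from (x : bin_seq) z (zP : zero_enum x z) (c : int) r :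
    calZ x -> (0 < r)%N -> cyclic_gaps z c r ->
  built_from x (zero_word x z c r).
Proof.
move=> Zx r0 D; split=> //; set v := zero_word x z c r.
(* In [is_biconcat] the block with index 1 starts at coordinate 0, hence [i - 1]. *)
pose e (i : int) : int := c + (i - 1) * r%:Z; pose p i := z (e i) - z c.
have eS (i : int) : e (i + 1) = e i + r%:Z by rewrite /e; lia.
have sz i : (size v)%:Z = z (e i + r%:Z - 1) - z (e i) + 1.
  rewrite -(size_zero_word zP _ r0) (cyclic_gaps_copy zP r0 D) //.
  have -> : e i - c = 0 + (i - 1) * r%:Z by rewrite /e; lia.
  by rewrite dvdz_addM dvdz0.
have vE i : v = word_at x (z (e i)) (size v).
  rewrite {1}/v -(cyclic_gaps_copy zP r0 D (i := e i)).
    rewrite /zero_word; congr (word_at _ _ _).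
    have := sz i; have : z (e i) <= z (e i + r%:Z - 1).
      by apply: (zero_enum_le zP); lia.
    lia.
  have -> : e i - c = 0 + (i - 1) * r%:Z by rewrite /e; lia.
  by rewrite dvdz_addM dvdz0.
exists (z c), (fun i : int => absz (z (e (i + 1)) - z (e i + r%:Z - 1) - 1)%R), p.
split; first by rewrite /p /e subrr mul0r addr0 subrr.
move=> i; set s := absz _.
have e1 : e i + r%:Z - 1 + 1 = e (i + 1) by rewrite eS; lia.
have [lt1 _ ones] := zP (e i + r%:Z - 1); rewrite e1 in lt1 ones.
have sE : s%:Z = z (e (i + 1)) - z (e i + r%:Z - 1) - 1 by rewrite /s; lia.
have szi := sz i; split; first by rewrite /p; lia.
have -> : word_at (shift (z c) x) (p i) (size v + s) =
    word_at x (z (e i)) (size v + s).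
  by apply/eq_word_at => m _ _; rewrite /shift /p; congr x; lia.
rewrite word_at_cat -vE; congr (_ ++ _); apply: word_at_ones => m m1 m2.
apply: ones; lia.
Qed.

(** * Comparing two words from which the same sequence is built *)

Lemma gaps_comparison (x : bin_seq) z (zP : zero_enum x z) (c : int) r (c' : int) q :
    (forall d, 0 < d -> ~ forall m, x (m + d) = x m) ->
    (0 < r)%N -> (0 < q)%N -> cyclic_gaps z c r -> cyclic_gaps z c' q ->
  exists e, [/\ cyclic_gaps z e r, cyclic_gaps z e q,
    zero_word x z c r = zero_word x z e r &
    zero_word x z c' q = zero_word x z e q].
Proof.
move=> aper r0 q0 Dr Dq.
have [e /andP[er eq]] := cyclic_gaps_meet zP aper r0 q0 Dr Dq.
exists e; split.
- exact: cyclic_gaps_shift Dr.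
- exact: cyclic_gaps_shift Dq.
- by rewrite (cyclic_gaps_copy zP r0 Dr).
- by rewrite (cyclic_gaps_copy zP q0 Dq).
Qed.

Lemma size_zero_word_le x z (zP : zero_enum x z) (c : int) r q :
  (0 < r)%N -> (0 < q)%N ->
  (size (zero_word x z c r) <= size (zero_word x z c q))%N = (r <= q)%N.
Proof.
move=> r0 q0; have sr := size_zero_word zP c r0; have sq := size_zero_word zP c q0.
have := zero_enum_lt zP (c + q%:Z - 1) (c + r%:Z - 1).
lia.
Qed.

Lemma calF_spaced v ss : calF v -> calF (spaced v ss).
Proof.
move=> Fv; case: (Fv) => hv lv.
elim/last_ind: ss => [|ss s [IHh _]]; first by rewrite /spaced cats0.
rewrite spaced_rcons; split; last by rewrite !last_cat; case: v lv {Fv hv IHh}.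
by move: IHh; rewrite /spaced; case: v hv {Fv lv} => [|a v'].
Qed.

(** Read from a common starting zero, [v] and [u] consist of the first [r] and the first [q] zeros.
    Rounding [q] up to a multiple of [r] completes the block in which [u] ends and so adds at most
    one copy of [v]. *)
Lemma built_from_extend (x : bin_seq) z (zP : zero_enum x z) u v :
    (forall d, 0 < d -> ~ forall m, x (m + d) = x m) ->
    calF v -> built_from x v -> calF u -> built_from x u ->
    (size v <= size u)%N ->
  exists u', [/\ calF u', (size u' <= size u + size v)%N,
    word_built_from u' v & prefix u u'].
Proof.
move=> aper Fv [_ [n [s /(biconcat_gaps zP Fv) [c [r [r0 Dr vE]]]]]].
move=> Fu [_ [n' [s' /(biconcat_gaps zP Fu) [c' [q [q0 Dq uE]]]]]].
have [e [Er Eq vE' uE']] := gaps_comparison zP aper r0 q0 Dr Dq.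
rewrite {}uE {}vE {}uE' {}vE' size_zero_word_le // => {Fu Fv} rq.
(* If [q = r], then [u] is a single copy, whereas [word_built_from] asks for at least two; a second
   one is appended with spacer 0. *)
have [->|qr] := eqVneq q r.
  set w := zero_word _ _ _ _; exists (spaced w [:: 0%N]); split.
  - exact: calF_spaced (calF_zero_word zP e r0).
  - by rewrite /spaced /= cats0 size_cat.
  - by exists [:: 0%N].
  - by rewrite /spaced; exact: prefix_prefix.
(* [k.+1] is [q / r] rounded up, and zero number [k * r] opens the block containing the last zero of
   [u]. *)
pose k := (q.-1 %/ r)%N.
have k0 : (0 < k)%N by rewrite divn_gt0 //; lia.
have [ss sk wE] := zero_word_spaced zP k r0 Er.
have kq : (q <= k.+1 * r)%N by have := ltn_ceil q.-1 r0; rewrite -/k; lia.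
exists (zero_word x z e (k.+1 * r)); split.
- by apply: (calF_zero_word zP); rewrite muln_gt0.
- have kr0 : (0 < k.+1 * r)%N by rewrite muln_gt0.
  have S1 := size_zero_word zP e kr0; have S2 := size_zero_word zP e r0.
  have S3 := size_zero_word zP e q0.
  have kq' : (k * r <= q.-1)%N by exact: leq_divM.
  have le : z (e + k%:Z * r%:Z) <= z (e + q%:Z - 1) by apply: (zero_enum_le zP); lia.
  have r1 : (r.-1 < r)%N by lia.
  have dk : (r%:Z %| e + k%:Z * r%:Z - e)%Z.
    have -> : e + k%:Z * r%:Z - e = 0 + k%:Z * r%:Z by lia.
    by rewrite dvdz_addM dvdz0.
  have := cyclic_gaps_block Er dk r1.
  have -> : e + k%:Z * r%:Z + r.-1%:Z = e + (k.+1 * r)%N%:Z - 1 by lia.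
  have -> : e + r.-1%:Z = e + r%:Z - 1 by lia.
  lia.
- by exists ss; rewrite ?sk.
- exact: prefix_zero_word.
Qed.

(** * Existence of the numbering for words with zeros unbounded on both sides *)

Lemma calZP (x : bin_seq) : calZ x <->
  forall M : int, (exists m : int, M < m /\ x m = false) /\
                  (exists m : int, m < M /\ x m = false).
Proof.
split=> [[xpos xneg] M|unb].
  split; apply: contrapT => noz.
    apply: xpos; apply: (sub_finite_set (B := Posz @` `I_(`|M|.+1)%N)).
      move=> m /= [m0 xm]; exists `|m|%N => /=; last lia.
      have [//|mM] := ltnP `|m|%N `|M|.+1%N.
      by exfalso; apply: noz; exists m; split => //; lia.
    by apply: finite_image; exact: finite_II.
  apply: xneg; apply: (sub_finite_set (B := (fun n : nat => - n%:Z) @` `I_(`|M|.+1)%N)).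
    move=> m /= [m0 xm]; exists `|m|%N => /=; last lia.
    have [//|mM] := ltnP `|m|%N `|M|.+1%N.
    by exfalso; apply: noz; exists m; split => //; lia.
  by apply: finite_image; exact: finite_II.
have bounded (S : set int) : finite_set S ->
    exists M : int, forall m, S m -> - M < m /\ m < M.
  move=> /finite_seqP[s ->] {S}; elim: s => [|a s [M MP]]; first by exists 0.
  exists (Num.max M (`|a|%N%:Z + 1)) => m /=.
  rewrite inE => /orP[/eqP ->|ms]; first lia.
  have := MP m ms; lia.
split=> /bounded[M MP].
  have [[m [Mm xm]] _] := unb (Num.max M 0).
  by have [] := MP m; [split => //; lia|lia].
have [_ [m [Mm xm]]] := unb (Num.min (- M) 0).
by have [] := MP m; [split => //; lia|lia].
Qed.

Lemma zero_enum_exists (x : bin_seq) : calZ x -> exists z, zero_enum x z.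
Proof.
move=> /calZP unb.
have nextP (a : int) : exists b : int, [/\ a < b, x b = false &
    forall m : int, a < m -> m < b -> x m = true].
  have [[b [ab xb]] _] := unb a.
  have ex : exists n : nat, ~~ x (a + 1 + n%:Z).
    exists (absz (b - (a + 1))%R).
    by rewrite (_ : a + 1 + _ = b) ?xb //; lia.
  case: (ex_minnP ex) => n xn nmin; exists (a + 1 + n%:Z); split; first lia.
    exact: negbTE.
  move=> m am mn; apply: contraT => xm.
  have := nmin (absz (m - (a + 1))%R).
  have -> : a + 1 + (absz (m - (a + 1))%R)%:Z = m by lia.
  by move=> /(_ xm); lia.
have prevP (b : int) : exists a : int, [/\ a < b, x a = false &
    forall m : int, a < m -> m < b -> x m = true].
  have [_ [a [ab xa]]] := unb b.
  have ex : exists n : nat, ~~ x (b - 1 - n%:Z).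
    exists (absz (b - 1 - a)%R).
    by rewrite (_ : b - 1 - _ = a) ?xa //; lia.
  case: (ex_minnP ex) => n xn nmin; exists (b - 1 - n%:Z); split; first lia.
    exact: negbTE.
  move=> m am mn; apply: contraT => xm.
  have := nmin (absz (b - 1 - m)%R).
  have -> : b - 1 - (absz (b - 1 - m)%R)%:Z = m by lia.
  by move=> /(_ xm); lia.
(* Start at the first zero after position 0 and iterate the successor and the predecessor; [Negz n]
   stands for -(n+1), hence [n.+1] steps back. *)
have [nx nxP] := choice nextP; have [pv pvP] := choice prevP.
pose z (i : int) : int := match i with
  | Posz n => iter n nx (nx 0)
  | Negz n => iter n.+1 pv (nx 0) end.
exists z; have z0 i : x (z i) = false.
  by case: i => [[|n]|n] /=; [have [] := nxP 0|case: (nxP (iter n nx (nx 0)))|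
    case: (pvP (iter n pv (nx 0)))].
case=> [n|[|n]].
- have -> : Posz n + 1 = Posz n.+1 by lia.
  by split; rewrite ?z0 //=; have [] := nxP (iter n nx (nx 0)).
- have -> : Negz 0 + 1 = Posz 0 by lia.
  by split; rewrite ?z0 //=; have [] := pvP (nx 0).
- have -> : Negz n.+1 + 1 = Negz n by lia.
  by split; rewrite ?z0 //=; have [] := pvP (iter n.+1 pv (nx 0)).
Qed.

(** * Rank-1 words *)

Lemma spaced_cat v a s b :
  spaced v (a ++ s :: b) = spaced v a ++ nseq s true ++ spaced v b.
Proof. by rewrite /spaced map_cat flatten_cat /= -!catA. Qed.

Lemma spaced_spaced v a b : spaced (spaced v a) b =
  spaced v (a ++ flatten [seq s :: a | s <- b]).
Proof.
elim/last_ind: b => [|b s IHb]; first by rewrite cats0 /spaced cats0.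
by rewrite spaced_rcons IHb map_rcons flatten_rcons [in RHS]catA spaced_cat.
Qed.

Lemma rank1_approx_spaced r s m n : (m <= n)%N ->
  exists ss, rank1_approx r s n = spaced (rank1_approx r s m) ss.
Proof.
move=> /subnK <-; elim: (n - m)%N => [|k [ss IHk]].
  by exists [::]; rewrite /spaced cats0.
by rewrite addSn /= IHk spaced_spaced; eexists.
Qed.

Lemma rank1_approx_gt0 r s n : (0 < size (rank1_approx r s n))%N.
Proof. by elim: n => //= n IHn; rewrite /spaced size_cat; lia. Qed.

Lemma calF_rank1_approx r s n : calF (rank1_approx r s n).
Proof. by elim: n => //= n IHn; exact: calF_spaced. Qed.

Lemma size_spaced v ss :
  size (spaced v ss) = ((size ss).+1 * size v + sumn ss)%N.
Proof.
elim/last_ind: ss => [|ss s IHs]; first by rewrite /spaced cats0 mul1n addn0.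
by rewrite spaced_rcons size_cat IHs size_cat size_nseq size_rcons sumn_rcons; lia.
Qed.

Lemma size_rank1_approx r s : (forall n, 1 < r n)%N ->
  forall n, (n < size (rank1_approx r s n))%N.
Proof.
move=> r1; elim=> //= n IHn; rewrite size_spaced size_map size_iota.
by have := r1 n; case: (r n) => [|[|k]] //= _; lia.
Qed.

(** Bi-infinite repetition of [w], which embeds a finite approximation of a rank-1 word into a word
    of [calZ]. The default [true] is never read when [w] is nonempty. *)
Definition periodic_seq (w : seq bool) : bin_seq :=
  fun m : int => nth true w `|(m %% (size w)%:Z)%Z|.

Lemma periodic_seqE w (q : int) (a : nat) : (a < size w)%N ->
  periodic_seq w (q * (size w)%:Z + a%:Z) = nth true w a.
Proof.
by move=> aw; rewrite /periodic_seq modzMDl modz_small //; lia.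
Qed.

(** A final spacer 0 lets every copy of [v] be followed by a spacer, as in [is_biconcat]. *)
Lemma spaced_blocks v ss :
  spaced v ss = flatten [seq v ++ nseq s true | s <- rcons ss 0%N].
Proof.
elim: ss => [|s ss IHs]; first by rewrite /spaced /= !cats0.
have := spaced_cat v [::] s ss; rewrite /= => ->.
by rewrite IHs {1}/spaced /= cats0 catA.
Qed.

Lemma periodic_seq_biconcat v ss : (0 < size v)%N ->
  exists s, is_biconcat v s (periodic_seq (spaced v ss)).
Proof.
move=> v0; pose es := rcons ss 0%N; pose bs := [seq v ++ nseq s true | s <- es].
have wE : spaced v ss = flatten bs by exact: spaced_blocks.
pose w := flatten bs; pose K := size es; rewrite wE -/w.
have K0 : (0 < K)%N by rewrite /K size_rcons.
have sbs : size bs = K by rewrite size_map.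
pose off j := size (flatten (take j bs)).
(* Block [i] is block number [md i] of repetition number [dv i]; again block 1 comes at coordinate
   0. *)
pose dv (i : int) : int := ((i - 1) %/ K%:Z)%Z.
pose md (i : int) : nat := `|((i - 1) %% K%:Z)%Z|%N.
have mdK i : (md i < K)%N.
  rewrite /md; have := @ltz_pmod (i - 1) K%:Z; have := modz_ge0 (i - 1) (d := K%:Z); lia.
have dmE i : i - 1 = dv i * K%:Z + (md i)%:Z.
  rewrite /md /dv; have := divz_eq (i - 1) K%:Z; have := modz_ge0 (i - 1) (d := K%:Z); lia.
pose s (i : int) : nat := nth 0%N es (md i).
pose p (i : int) : int := dv i * (size w)%:Z + (off (md i))%:Z.
have blockE i : nth [::] bs (md i) = v ++ nseq (s i) true.
  by rewrite (nth_map 0%N).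
have wsplit i : w = flatten (take (md i) bs) ++ (v ++ nseq (s i) true) ++
    flatten (drop (md i).+1 bs).
  rewrite -blockE -[RHS]/(_ ++ flatten (_ :: _)) -drop_nth ?sbs //.
  by rewrite -flatten_cat cat_take_drop.
have offS i : off (md i).+1 = (off (md i) + (size v + s i))%N.
  rewrite /off (take_nth [::]) ?sbs // flatten_rcons size_cat blockE.
  by rewrite size_cat size_nseq.
exists s, p; split.
  by rewrite /p /dv /md subrr div0z mod0z mul0r /off take0.
move=> i; split.
  have [jK|jK] := ltnP (md i).+1 K.
    have e : i + 1 - 1 = dv i * K%:Z + (md i).+1%:Z by have := dmE i; lia.
    have e1 : dv (i + 1) = dv i.
      rewrite {1}/dv e divzMDl; last lia.
      by rewrite divz_small ?addr0 //; lia.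
    have e2 : md (i + 1) = (md i).+1.
      by rewrite {1}/md e modzMDl modz_small //; lia.
    by rewrite /p e1 e2 offS; lia.
  have e : i + 1 - 1 = (dv i + 1) * K%:Z + 0.
    by have := dmE i; have := mdK i; lia.
  have e1 : dv (i + 1) = dv i + 1.
    by rewrite {1}/dv e divzMDl ?div0z ?addr0 //; lia.
  have e2 : md (i + 1) = 0%N by rewrite {1}/md e modzMDl mod0z.
  have sw : size w = (off (md i) + (size v + s i))%N.
    by rewrite -offS /off take_oversize // sbs.
  have off0 : off 0%N = 0%N by rewrite /off take0.
  by rewrite /p e1 e2 off0; lia.
apply: (@eq_from_nth _ true); first by rewrite size_word_at size_cat size_nseq.
rewrite size_word_at => m mv; rewrite nth_mkseq // /p -addrA.
have -> : (off (md i))%:Z + m%:Z = (off (md i) + m)%N%:Z by lia.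
have sw : (off (md i) + (size v + s i) <= size w)%N.
  by rewrite (wsplit i) !size_cat size_nseq /off; lia.
rewrite periodic_seqE; last by lia.
rewrite {1}(wsplit i) nth_cat -/(off _) ltnNge leq_addr /= addKn nth_cat.
by rewrite size_cat size_nseq mv.
Qed.

Lemma calZ_periodic_seq w : calF w -> calZ (periodic_seq w).
Proof.
move=> Fw; have w0 := calF_gt0 Fw.
have zero q : periodic_seq w (q * (size w)%:Z) = false.
  by rewrite -[_ * _]addr0 periodic_seqE // nth0; case: Fw.
apply/calZP => M; split.
  by exists ((`|M|%N%:Z + 1) * (size w)%:Z); split; [nia|exact: zero].
by exists (- (`|M|%N%:Z + 1) * (size w)%:Z); split; [nia|exact: zero].
Qed.

(** If every [c] below [B] failed at some stage, all of them would fail at the largest of these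
    stages. *)
Lemma antitone_pigeonhole (B : nat) (P : nat -> nat -> Prop) :
    (forall M N c, (M <= N)%N -> P N c -> P M c) ->
    (forall N, exists2 c, (c < B)%N & P N c) ->
  exists c, forall N, P N c.
Proof.
move=> anti ex; apply: contrapT => none.
have /choice[f fP] : forall c, exists N, ~ P N c.
  move=> c; apply: contrapT => allN; apply: none; exists c => N.
  by apply: contrapT => nP; apply: allN; exists N.
have [c cB Pc] := ex (\max_(c < B) f c).
apply: (fP c); apply: anti Pc; exact: (leq_bigmax (Ordinal cB)).
Qed.

(* The number r of zeros of v and the residue c of the block starts are at most
   |v|, so one pair (c, r) serves infinitely many windows, hence all of them. *)
Lemma cyclic_gaps_limit (x : bin_seq) z (zP : zero_enum x z) v :
    calF v ->
    (forall a L, exists y b n s, [/\ calZ y, is_biconcat v s (shift n y) &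
       word_at x a L = word_at y b L]) ->
  exists (c : int) (r : nat),
    [/\ (0 < r)%N, cyclic_gaps z c r & v = zero_word x z c r].
Proof.
move=> Fv app; have v0 := calF_gt0 Fv.
pose P N r c := (0 < r)%N /\ forall i : int, (`|i| <= N)%N -> (r%:Z %| i - c%:Z)%Z ->
  word_at x (z i) (size v) = v /\ (size v)%:Z = z (i + r%:Z - 1) - z i + 1.
have antiP M N r c : (M <= N)%N -> P N r c -> P M r c.
  by move=> MN [r0 rP]; split=> // i iM; apply: rP; lia.
suff exP N : exists2 r, (r < (size v).+1)%N & exists2 c, (c < (size v).+1)%N & P N r c.
  have [|r rP] := antitone_pigeonhole
      (P := fun N r => exists2 c, (c < (size v).+1)%N & P N r c) _ exP.
    by move=> M N r MN [c cv Pc]; exists c => //; exact: antiP Pc.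
  have [|c cP] := antitone_pigeonhole (P := fun N c => P N r c) _ rP.
    by move=> M N c; exact: antiP.
  have [r0 _] := cP 0%N; exists c%:Z, r.
  have copy (k : int) : word_at x (z (c%:Z + k * r%:Z)) (size v) = v /\
      (size v)%:Z = z (c%:Z + k * r%:Z + r%:Z - 1) - z (c%:Z + k * r%:Z) + 1.
    have [_] := cP (absz (c%:Z + k * r%:Z)%R); apply => //.
    have -> : c%:Z + k * r%:Z - c%:Z = 0 + k * r%:Z by lia.
    by rewrite dvdz_addM dvdz0.
  have [|k|D E] := cyclic_gaps_of_copies zP (c := c%:Z) (v := v) r0; last by split.
    by have [_] := copy 0; rewrite mul0r addr0.
  by have [] := copy k.
(* The window reaches from zero -N to zero N, with room for a copy of [v] starting at the latter. *)
pose L := (absz (z N%:Z - z (- N%:Z))%R + (size v).+1)%N.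
have LE : L%:Z = z N%:Z - z (- N%:Z) + (size v).+1%:Z.
  have : z (- N%:Z) <= z N%:Z by apply: (zero_enum_le zP); lia.
  by rewrite /L; lia.
have [y [b [n [s [Zy ybi xy]]]]] := app (z (- N%:Z)) L.
have [t tP] := zero_enum_exists Zy.
have [c0 [r [r0 D vE]]] := biconcat_gaps tP Fv ybi.
have sv := size_zero_word tP c0 r0; rewrite -vE in sv.
have rv : (r < (size v).+1)%N.
  have := zero_enum_gap tP c0 r.-1.
  have -> : c0 + r.-1%:Z = c0 + r%:Z - 1 by lia.
  lia.
exists r => //.
have [j tj] : exists j, t j = b.
  apply: (zero_enum_surj tP); have [_ + _] := zP (- N%:Z).
  move/eq_word_at: (xy) => /(_ 0); rewrite !addr0 => -> //; lia.
(* Zero -N of [x] matches zero [j] of [y], so the coset of [c0] in the numbering of [y] becomes that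
   of [c0 - N - j] in the numbering of [x]. *)
subst b; pose c := `|((c0 - N%:Z - j) %% r%:Z)%Z|%N.
have cE : c0 - N%:Z - j = ((c0 - N%:Z - j) %/ r%:Z)%Z * r%:Z + c%:Z.
  rewrite /c; have := divz_eq (c0 - N%:Z - j) r%:Z.
  have := modz_ge0 (c0 - N%:Z - j) (d := r%:Z); lia.
have cr : (c < r)%N.
  rewrite /c; have := @ltz_pmod (c0 - N%:Z - j) r%:Z.
  have := modz_ge0 (c0 - N%:Z - j) (d := r%:Z); lia.
exists c; first lia.
split=> // i iN ic; have [k kE] : exists k : nat, i = - N%:Z + k%:Z.
  by exists (absz (i + N%:Z)%R); lia.
have zi : z (- N%:Z) <= z i by apply: (zero_enum_le zP); lia.
have zi' : z i <= z N%:Z by apply: (zero_enum_le zP); lia.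
have tk : t (j + k%:Z) = t j + (z i - z (- N%:Z)).
  by rewrite kE; apply: (zero_enum_agree zP tP xy); rewrite -kE; lia.
have cop : (r%:Z %| j + k%:Z - c0)%Z.
  have -> : j + k%:Z - c0 = i - c%:Z + - ((c0 - N%:Z - j) %/ r%:Z)%Z * r%:Z by lia.
  by rewrite dvdz_addM.
have tr : (size v)%:Z = t (j + k%:Z + r%:Z - 1) - t (j + k%:Z) + 1.
  by rewrite -(size_zero_word tP _ r0) (cyclic_gaps_copy tP r0 D cop) -vE.
have vW : word_at y (t (j + k%:Z)) (size v) = v.
  by rewrite {2}vE -(cyclic_gaps_copy tP r0 D cop) [RHS]zero_wordE
    (cyclic_gaps_copy tP r0 D cop) -vE.
split.
  rewrite -[RHS]vW; apply/eq_word_at => m m0 mv.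
  move/eq_word_at: (xy) => /(_ (z i - z (- N%:Z) + m)).
  have -> : z (- N%:Z) + (z i - z (- N%:Z) + m) = z i + m by lia.
  have -> : t j + (z i - z (- N%:Z) + m) = t (j + k%:Z) + m by lia.
  by apply; lia.
have e1 : j + k%:Z + r%:Z - 1 = j + (k + r.-1)%N%:Z by lia.
have := zero_enum_agree tP zP (esym xy) (k := (k + r.-1)%N).
rewrite -e1; have -> : - N%:Z + (k + r.-1)%N%:Z = i + r%:Z - 1 by lia.
move=> ->; lia.
Qed.

(** Starting from the word 0, each step passes to the lcm with a longer word from which [y] is
    built. The result is made of copies of its predecessor and occurs in [y], so the steps define a
    rank-1 word whose subwords all occur in [y]. *)
Lemma rank1_word_chain (y : bin_seq) z (zP : zero_enum y z) :
    (forall d, 0 < d -> ~ forall m, y (m + d) = y m) ->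
    (forall n : nat, exists v, [/\ calF v, (n <= size v)%N & built_from y v]) ->
  exists V, [/\ rank1_word V,
    forall w, subword_of V w -> exists a, word_at y a (size w) = w &
    forall N : nat, exists a (n : nat), (N <= n)%N /\ subword_of V (word_at y a n)].
Proof.
move=> aper built.
pose good w := exists (c : int) (r : nat),
  [/\ (0 < r)%N, cyclic_gaps z c r & w = zero_word y z c r].
have step w : exists ss, good w -> good (spaced w ss) /\ (0 < size ss)%N.
  (* The later use of [choice] needs a value for every [w]; words that are not [good] get the empty
     list. *)
  have [[c [r [r0 Dr wE]]]|nw] := pselect (good w); last by exists [::].
  (* A strictly longer word has more zeros, so the lcm is a proper multiple of [r] and holds at
     least two copies of [w]. *)
  have [v [Fv sv [_ [n [s bi]]]]] := built (size w).+1.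
  have [c' [q [q0 Dq vE]]] := biconcat_gaps zP Fv bi.
  have [e [Er Eq wE' vE']] := gaps_comparison zP aper r0 q0 Dr Dq.
  rewrite {}wE' {c Dr} in wE; rewrite {}vE' {c' Dq} in vE.
  have rq : (r < q)%N.
    by rewrite ltnNge -(size_zero_word_le zP e q0 r0) -wE -vE -ltnNge.
  have /dvdnP[k kE] := dvdn_lcml r q.
  have L0 : (0 < lcmn r q)%N by rewrite lcmn_gt0 r0.
  have k1 : (1 < k)%N.
    have := dvdn_leq L0 (dvdn_lcmr r q); rewrite kE => qk.
    by case: k qk {kE} => [|[|k]] //; rewrite ?mul0n ?mul1n; lia.
  have [ss sk lE] := zero_word_spaced zP k.-1 r0 Er.
  exists ss => _; rewrite sk; split; last by lia.
  exists e, (lcmn r q); split => //; first exact: cyclic_gaps_lcm.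
  by rewrite wE -lE kE prednK //; lia.
have [f fP] := choice step.
pose W n := iter n (fun w => spaced w (f w)) [:: false].
have W0 : good (W 0%N).
  exists 0, 1%N; split => //; first by move=> i; rewrite dvd1z.
  rewrite /zero_word (_ : 0 + 1%:Z - 1 = 0) // subrr.
  have [_ y0 _] := zP 0; rewrite [LHS]/= -{1}y0 /word_at /=.
  by congr [:: y _]; rewrite addr0.
have WP n : good (W n) by elim: n => //= n IHn; have [] := fP _ IHn.
have fW n : (0 < size (f (W n)))%N by have [] := fP _ (WP n).
(* One more copy than spacers; the spacers of [rank1_approx] are indexed from 1. *)
pose r n := (size (f (W n))).+1; pose s n i := nth 0%N (f (W n)) i.-1.
have r1 n : (1 < r n)%N by rewrite ltnS fW.
have WE n : rank1_approx r s n = W n.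
  elim: n => //= n ->; congr spaced; apply: (@eq_from_nth _ 0%N).
    by rewrite size_map size_iota.
  rewrite size_map size_iota => i ir.
  by rewrite (nth_map 0%N) ?size_iota // nth_iota.
have szW n : (n < size (W n))%N by rewrite -WE; exact: size_rank1_approx.
(* [W i] is longer than [i], so the default is never read. *)
pose V i := nth true (W i) i.
have VW n i : (i < size (W n))%N -> V i = nth true (W n) i.
  move=> iW; have pre m k : (m <= k)%N -> (i < size (W m))%N ->
      nth true (W k) i = nth true (W m) i.
    move=> mk im; have [ss] := rank1_approx_spaced r s mk.
    by rewrite !WE => ->; rewrite /spaced nth_cat im.
  rewrite /V; case/orP: (leq_total i n) => le; first by rewrite (pre i n).
  exact: pre.
have mkV n : mkseq V (size (W n)) = W n.
  apply: (@eq_from_nth _ true); rewrite size_mkseq // => i iW.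
  by rewrite nth_mkseq // (VW n).
exists V; split.
- by exists r, s; split => // n; rewrite WE.
- move=> w [p wE]; have [c [q [q0 _ WnE]]] := WP (p + size w)%N.
  exists (z c + p%:Z); rewrite [RHS]wE.
  apply: (@eq_from_nth _ true); rewrite size_word_at ?size_mkseq //.
  move=> j jw; rewrite !nth_mkseq //.
  have pj : (p + j < size (W (p + size w)%N))%N.
    by apply: leq_trans (szW _); lia.
  rewrite (VW _ _ pj); rewrite WnE size_word_at in pj.
  rewrite WnE nth_mkseq //; congr y; lia.
- move=> N; have [c [q [q0 _ WnE]]] := WP N; exists (z c), (size (W N)).
  split; first exact: ltnW.
  by exists 0%N; rewrite size_word_at mkV {2}WnE [RHS]zero_wordE -WnE.
Qed.

(** Every window of [x] lies in some approximation that extends stage [k] by spaced copies.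
    Repeating that approximation periodically gives the words demanded by [cyclic_gaps_limit]. *)
Lemma rank1_subshift_gaps V r s (r1 : forall n, (1 < r n)%N)
    (VE : forall n, mkseq V (size (rank1_approx r s n)) = rank1_approx r s n)
    (x : bin_seq) z (zP : zero_enum x z) :
  rank1_subshift V x -> forall k, exists (c : int) (q : nat),
    [/\ (0 < q)%N, cyclic_gaps z c q & rank1_approx r s k = zero_word x z c q].
Proof.
move=> Vx k; apply: (cyclic_gaps_limit zP (calF_rank1_approx r s k)) => a L.
have [p] := Vx a L; rewrite size_word_at => xV.
pose n := (k + (p + L))%N; have [ss nE] := rank1_approx_spaced r s (leq_addr (p + L) k).
have [g gP] := periodic_seq_biconcat ss (rank1_approx_gt0 r s k).
exists (periodic_seq (rank1_approx r s n)), p%:Z, 0, g; split.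
- by apply: calZ_periodic_seq; exact: calF_rank1_approx.
- rewrite (_ : shift 0 _ = periodic_seq (rank1_approx r s n)) ?nE //.
  by apply/funext => m; rewrite /shift addr0.
rewrite xV; apply: (@eq_from_nth _ true); rewrite size_mkseq ?size_word_at //.
move=> j jL; rewrite !nth_mkseq //.
have pj : (p + j < size (rank1_approx r s n))%N.
  by have := size_rank1_approx s r1 n; rewrite /n; lia.
rewrite -[p%:Z + _]/((p + j)%N%:Z) -[(p + j)%N%:Z]add0r.
rewrite -[0 in RHS](mul0r (size (rank1_approx r s n))%:Z).
by rewrite periodic_seqE // -[in RHS]VE nth_mkseq.
Qed.

(** If the zeros of [x] stopped on one side, [x] would contain arbitrarily long runs of ones. *)
Lemma rank1_subshift_calZ V (x : bin_seq) :
  ~ rank1_subshift V (fun=> true) -> rank1_subshift V x -> calZ x.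
Proof.
move=> no1 Vx; apply/calZP => M; split; apply: contrapT => noz; apply: no1 => i k.
  rewrite (_ : word_at _ i k = word_at x (M + 1) k) //; apply/eq_word_at => m m0 mk.
  apply/esym; apply: contrapT => /negP/negbTE xm; apply: noz.
  by exists (M + 1 + m); split => //; lia.
rewrite (_ : word_at _ i k = word_at x (M - k%:Z) k) //; apply/eq_word_at => m m0 mk.
apply/esym; apply: contrapT => /negP/negbTE xm; apply: noz.
by exists (M - k%:Z + m); split => //; lia.
Qed.

(** * Return sequences of a minimal Cantor system *)

Lemma zpowS (X : topologicalType) (T : homeo X X) m x :
  zpow T (m + 1) x = T (zpow T m x).
Proof.
case: m => [n|[|n]].
- by rewrite (_ : Posz n + 1 = Posz n.+1) //; lia.
- by rewrite (_ : Negz 0 + 1 = Posz 0) /= ?homeo_invK.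
- by rewrite (_ : Negz n.+1 + 1 = Negz n) /= ?homeo_invK //; lia.
Qed.

Lemma zpowD (X : topologicalType) (T : homeo X X) m n x :
  zpow T (m + n) x = zpow T m (zpow T n x).
Proof.
apply: (int_ind_pred (P := fun m => zpow T (m + n) x = zpow T m (zpow T n x)) (a := 0)).
- by rewrite add0r.
- by move=> i IHi; rewrite addrAC !zpowS IHi.
- by move=> i; rewrite addrAC !zpowS => /(can_inj (homeo_funK T)).
Qed.

Lemma zpow_continuous (X : topologicalType) (T : homeo X X) m :
  continuous (zpow T m).
Proof.
have iterc (f : X -> X) n : continuous f -> continuous (iter n f).
  move=> cf; elim: n => [|n IHn] x; first exact: cvg_id.
  exact: (continuous_comp (IHn x) (cf _)).
case: m => n /=; first exact: iterc (@homeo_fun_cont _ _ T).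
exact: (iterc _ n.+1 (@homeo_inv_cont _ _ T)).
Qed.

Lemma zpow_conj (X Y : topologicalType) (T : homeo X X) (S : int -> Y -> Y)
    (phi : X -> Y) :
    (forall y, S 0 y = y) -> (forall m n y, S (m + n) y = S m (S n y)) ->
    (forall x, phi (T x) = S 1 (phi x)) ->
  forall m x, phi (zpow T m x) = S m (phi x).
Proof.
move=> S0 SD phiT m x.
apply: (int_ind_pred (P := fun m => phi (zpow T m x) = S m (phi x)) (a := 0)).
- by rewrite S0.
- by move=> i IHi; rewrite zpowS phiT IHi -SD addrC.
- move=> i; rewrite zpowS phiT (addrC i) SD => /(congr1 (S (-1))).
  by rewrite -2!(SD (-1) 1) addNr !S0.
Qed.

Lemma Ret_zpow (X : topologicalType) (T : homeo X X) (A : set X) k x m :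
  Ret T A (zpow T k x) m = Ret T A x (m + k).
Proof. by rewrite /Ret -zpowD. Qed.

Lemma clopen_zpow (X : topologicalType) (T : homeo X X) (A : set X) m :
  clopen A -> clopen [set x | A (zpow T m x)].
Proof.
move=> [oA cA]; split.
  by move/continuousP: (zpow_continuous (T := T) (m := m)); exact.
by move/continuous_closedP: (zpow_continuous (T := T) (m := m)); exact.
Qed.

Lemma compact_seq_cluster (X : topologicalType) (u : nat -> X) :
    compact [set: X] ->
  exists x : X, forall U : set X, nbhs x U -> forall N, exists2 n, (N <= n)%N & U (u n).
Proof.
move=> /(_ (u @ \oo) _ filterT)[x [_ clx]]; exists x => U Ux N.
have [|_ [[n Nn <-] Un]] := clx (u @` [set n | (N <= n)%N]) U _ Ux.
  by exists N => // n Nn; exists n.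
by exists n.
Qed.

(** In a finite Hausdorff space every point is isolated, against perfectness. *)
Lemma minimal_cantor_infinite (R : realType) (X : metricType R)
    (T : homeo X X) (x0 : X) : minimal_cantor_system T -> ~ finite_set [set: X].
Proof.
move=> [[/perfectTP noiso _ hX _] _] finX; apply: (noiso x0).
rewrite -(setCK [set x0]) openC.
have /accessible_finite_set_closed := hausdorff_accessible hX; apply.
exact: sub_finite_set finX.
Qed.

(** A periodic orbit is finite, hence closed; being dense, it would be the whole infinite space. *)
Lemma minimal_cantor_aperiodic (R : realType) (X : metricType R)
    (T : homeo X X) (x : X) d :
  minimal_cantor_system T -> 0 < d -> zpow T d x <> x.
Proof.
move=> mT d0 per; apply: (minimal_cantor_infinite x mT).
have [[_ _ hX _] /(_ x) dx] := mT.
pose O := range (fun m : int => zpow T m x).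
have finO : finite_set O.
  apply: (sub_finite_set (B := (fun n : nat => zpow T n%:Z x) @` `I_(`|d|)%N)).
    move=> _ [m _ <-]; exists `|(m %% d)%Z|%N => /=.
      have := @ltz_pmod m d d0; have := modz_ge0 m (d := d); lia.
    have perk q : zpow T (q * d) x = x.
      apply: (int_ind_pred (P := fun q => zpow T (q * d) x = x) (a := 0)).
      - by rewrite mul0r.
      - by move=> i IHi; rewrite mulrDl mul1r zpowD per.
      - by move=> i; rewrite mulrDl mul1r zpowD per.
    have -> : zpow T m x = zpow T (m %% d)%Z x.
      by rewrite {1}(divz_eq m d) addrC zpowD perk.
    by rewrite -[in RHS](gez0_abs (modz_ge0 m _)) //; lia.
  by apply: finite_image; exact: finite_II.
rewrite (_ : [set: X] = O) //; apply/seteqP; split=> // y _; apply: contrapT => nOy.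
have cO : closed O by have /accessible_finite_set_closed := hausdorff_accessible hX; apply.
have [|t [nOt Ot]] := dx (~` O) _ (closed_openC cO); first by exists y.
exact: nOt.
Qed.

Lemma boolean_algebra_finite_dep (X : Type) (I : eqType) (B : set (set X))
    (D : I -> set X) : boolean_algebra_of_sets B -> (forall i, B (D i)) ->
  forall (l : seq I) (C : set X),
    (forall x y, (forall i : I, i \in l -> D i x <-> D i y) -> C x -> C y) -> B C.
Proof.
move=> [BT BU BC] BD; have BI P Q : B P -> B Q -> B (P `&` Q).
  by move=> BP BQ; rewrite -(setCK (P `&` Q)) setCI; apply/BC/BU; exact: BC.
elim=> [|i l IHl] C dep.
  have [[x Cx]|C0] := pselect (exists x, C x).
    by rewrite (_ : C = setT) //; apply/seteqP; split=> // y _; exact: dep Cx.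
  rewrite (_ : C = ~` setT); first exact: BC.
  by rewrite setCT; apply/seteqP; split=> // y Cy; apply: C0; exists y.
(* The saturation of [P] depends only on the sets indexed by [l]. Splitting [C] along [D i] and
   saturating each half recovers [C]. *)
pose sat P := [set x | exists2 y, (forall j : I, j \in l -> D j y <-> D j x) & P y].
have Bsat P : B (sat P).
  apply: IHl => x y xy [t tx Pt]; exists t => // j jl.
  by apply: iff_trans (tx j jl) (xy j jl).
have BDi := BD i.
rewrite (_ : C = (D i `&` sat (D i `&` C)) `|` (~` D i `&` sat (~` D i `&` C))).
  by apply: BU; apply: BI => //; exact: BC.
apply/seteqP; split=> x.
  by move=> Cx; have [Dx|Dx] := pselect (D i x); [left|right]; split=> //; exists x.
move=> [[Dx [y yx [Dy Cy]]]|[Dx [y yx [Dy Cy]]]]; apply: dep Cy => j;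
  by rewrite inE => /orP[/eqP ->//|]; exact: yx.
Qed.

(* Compactness: points that agree on ever larger windows have limits that agree
   everywhere, hence coincide. *)
Lemma clopen_finite_dep (X : topologicalType) (D : int -> set X) (C : set X) :
    compact [set: X] -> (forall i, clopen (D i)) ->
    (forall x y, (forall i, D i x <-> D i y) -> x = y) -> clopen C ->
  exists N : nat, forall x y,
    (forall i : int, (`|i| <= N)%N -> D i x <-> D i y) -> C x -> C y.
Proof.
move=> cX cD sep [oC cC]; apply: contrapT => noN.
have /choice[u uP] : forall N : nat, exists p : X * X,
    [/\ forall i : int, (`|i| <= N)%N -> D i p.1 <-> D i p.2, C p.1 & ~ C p.2].
  move=> N; apply: contrapT => nop; apply: noN; exists N => x y xy Cx.
  by apply: contrapT => nCy; apply: nop; exists (x, y).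
have [|[x y] cl] := compact_seq_cluster u (X := (X * X)%type).
  by rewrite -setXTT; exact: compact_setX.
have meet U V : open U -> open V -> U x -> V y ->
    forall N, exists2 n, (N <= n)%N & U (u n).1 /\ V (u n).2.
  move=> oU oV Ux Vy; apply: (cl [set p | U p.1 /\ V p.2]).
  by exists (U, V) => //=; split; exact: open_nbhs_nbhs.
have xy : x = y.
  apply: sep => i; have [oD clD] := cD i; have oDC := closed_openC clD.
  split=> Di; apply: contrapT => nDi.
    have [n iN [D1 D2]] := meet _ _ oD oDC Di nDi `|i|%N.
    by apply: D2; have [/(_ i iN) e _ _] := uP n; exact/e.
  have [n iN [D1 D2]] := meet _ _ oDC oD nDi Di `|i|%N.
  by apply: D1; have [/(_ i iN) e _ _] := uP n; exact/e.
have oCC := closed_openC cC.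
have [Cx|Cx] := pselect (C x).
  have Cy : C y by rewrite -xy.
  have [n _ [_]] := meet _ _ openT oC I Cy 0%N.
  by have [_ _] := uP n.
have [n _ [+ _]] := meet _ _ oCC openT Cx I 0%N.
by have [_ ? _] := uP n; apply.
Qed.

(** * From a rank-1 subshift to a generating clopen set *)

Lemma shiftD m n y : shift (m + n) y = shift m (shift n y).
Proof. by apply/funext => k; rewrite /shift addrA. Qed.

Lemma shift0 y : shift 0 y = y.
Proof. by apply/funext => k; rewrite /shift addr0. Qed.

Lemma coordinate_clopen (S : set bin_seq) (i : int) (b : bool) :
  clopen [set y : S | set_val y i = b].
Proof.
have ci : continuous (fun y : S => (set_val y : bin_seq) i).
  move=> y; apply: (continuous_comp (f := set_val : S -> bin_seq)
    (g := fun g : bin_seq => g i)).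
    exact: initial_continuous.
  exact: proj_continuous.
split.
  by move/continuousP: ci => /(_ [set b]); apply; exact: discrete_open.
by move/continuous_closedP: ci => /(_ [set b]); apply; exact: discrete_closed.
Qed.

Lemma rank1_conjugate_generating (R : realType) (X : metricType R)
    (T : homeo X X) (x0 : X) (hT : minimal_cantor_system T) V :
    rank1_word V -> conjugate T (@rank1_shift V) ->
  exists A : set X, [/\ clopen A, generating T A,
    calZ (Ret T A x0),
    (forall d, 0 < d -> ~ forall m, Ret T A x0 (m + d) = Ret T A x0 m) &
    forall n : nat, exists v, [/\ calF v, (n <= size v)%N & built_from (Ret T A x0) v]].
Proof.
move=> [r [s [r1 VE]]] [phi phiT]; pose f x : bin_seq := set_val (phi x).
have fT m x : f (zpow T m x) = shift m (f x).
  apply: zpow_conj => [||y]; [exact: shift0|exact: shiftD|].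
  by rewrite /f phiT.
have finj : injective f.
  by move=> x y /val_inj /(can_inj (homeo_funK phi)).
have fclopen i b : clopen [set x | f x i = b].
  have [oS cS] := coordinate_clopen (rank1_subshift V) i b; split.
    by move/continuousP: (@homeo_fun_cont _ _ phi) => /(_ _ oS).
  by move/continuous_closedP: (@homeo_fun_cont _ _ phi) => /(_ _ cS).
pose A := [set x | f x 0 = true].
have RetE x : Ret T A x = f x.
  apply/funext => m; rewrite /Ret; apply/idP/idP.
    by rewrite inE /A /= fT /shift add0r.
  by move=> fx; rewrite inE /A /= fT /shift add0r.
have fV x : rank1_subshift V (f x) by exact: set_valP.
(* The preimage of the constant sequence would be a fixed point of [T]. *)
have no1 : ~ rank1_subshift V (fun=> true).
  move=> V1; pose p1 : rank1_subshift V := exist _ (fun=> true) (mem_set V1).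
  apply: (minimal_cantor_aperiodic (T := T) (x := homeo_inv phi p1) (d := 1)) => //.
  by apply: finj; rewrite fT /f homeo_invK.
exists A; rewrite !RetE; split.
- exact: fclopen.
- move=> C cC B [/= BA BR].
  have [||x y xy|N NP] :=
    clopen_finite_dep (D := fun i => [set x | f x i = true]) _ _ _ cC.
  + by have [[]] := hT.
  + by move=> i; exact: fclopen.
  + by apply: finj; apply/funext => i; apply/idP/idP => /(xy i).
  have BD i : B [set x | f x i = true].
    (* The set where coordinate [i] is 1 is the image of [A] under the power [- i] of [T]. *)
    apply: BR; exists (- i) => //; apply/seteqP; split=> [_ [x Ax <-]|x fx].
      by rewrite /= fT /shift subrr.
    exists (zpow T i x); first by rewrite /A /= fT /shift add0r.
    by rewrite -zpowD addNr.
  apply: (boolean_algebra_finite_dep BA BD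
    (l := [seq k%:Z - N%:Z | k <- iota 0 (N + N).+1])) => x y xy.
  apply: NP => i iN; apply: xy; apply/mapP; exists (absz (i + N%:Z)%R); last by lia.
  by rewrite mem_iota; lia.
- exact: rank1_subshift_calZ no1 (fV x0).
- move=> d d0 per; apply: (minimal_cantor_aperiodic (T := T) (x := x0) hT d0).
  by apply: finj; rewrite fT; apply/funext => k; exact: per.
- move=> n; have Z0 := rank1_subshift_calZ no1 (fV x0).
  have [z zP] := zero_enum_exists Z0.
  have [c [q [q0 D vE]]] := rank1_subshift_gaps r1 VE zP (fV x0) n.
  exists (rank1_approx r s n); split; first exact: calF_rank1_approx.
    exact/ltnW/size_rank1_approx.
  by rewrite vE; exact: gaps_built_from.
Qed.

(** * From a generating clopen set to a conjugacy *)

Lemma RetP (X : topologicalType) (T : homeo X X) (A : set X) x m :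
  Ret T A x m <-> A (zpow T m x).
Proof. by rewrite /Ret; split => [|?]; rewrite inE. Qed.

(** The sets that do not separate [x] from [y] form a Boolean algebra. If the return sequences
    agree, it contains all translates of [A], hence all clopen sets, although some clopen set
    separates distinct points. *)
Lemma generating_Ret_inj (X : topologicalType) (T : homeo X X) (A : set X) :
  zero_dimensional X -> generating T A -> injective (Ret T A).
Proof.
move=> zd gen x y xy; apply: contrapT => /eqP /zd [U [cU Ux Uy]].
have Axy m : A (zpow T m x) <-> A (zpow T m y) by rewrite -!RetP xy.
have imE m t : (zpow T m @` A) t <-> A (zpow T (- m) t).
  split=> [[u Au <-]|At]; first by rewrite -zpowD addNr.
  by exists (zpow T (- m) t); rewrite // -zpowD subrr.
suff [xUy _] : [set S : set X | S x <-> S y] U by exact/Uy/xUy.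
apply: (gen U cU); split; last first.
  by move=> _ [m _ <-]; split=> /imE Am; apply/imE/Axy.
split=> //= [S S' /= Sxy S'xy|S /= Sxy]; first by rewrite /setU /= Sxy S'xy.
by rewrite /setC /= Sxy.
Qed.

Lemma Ret_nbhs (X : topologicalType) (T : homeo X X) (A : set X) x (i : int) (k : nat) :
  clopen A -> nbhs x [set t | word_at (Ret T A t) i k = word_at (Ret T A x) i k].
Proof.
move=> clA; have coord m : nbhs x [set t | Ret T A t m = Ret T A x m].
  have [oD cD] := clopen_zpow T m clA.
  case E : (Ret T A x m).
    apply: (filterS _ (open_nbhs_nbhs (conj oD _))) => [t /=|/=]; last exact/RetP.
    by move=> /RetP.
  apply: (filterS _ (open_nbhs_nbhs (conj (closed_openC cD) _))) => [t /= nt|/=].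
    by apply/negbTE/negP => /RetP.
  by move=> /RetP; rewrite E.
elim: k => [|k IHk]; first exact: filterE.
apply: filterS (filterI IHk (coord (i + k%:Z))) => t [/= e1 e2].
by rewrite -[k.+1]addn1 !word_at_cat e1; congr (_ ++ [:: _]); rewrite !addr0.
Qed.

Lemma word_at_Ret_zpow (X : topologicalType) (T : homeo X X) (A : set X) x j i k :
  word_at (Ret T A (zpow T j x)) i k = word_at (Ret T A x) (i + j) k.
Proof.
by apply/eq_word_at => m _ _; rewrite Ret_zpow; congr (Ret T A x _); rewrite addrAC.
Qed.

Lemma dense_orbit_window (X : topologicalType) (T : homeo X X) (A : set X) x y
    (i : int) (k : nat) :
    clopen A -> dense (range (fun m : int => zpow T m y)) ->
  exists m : int, word_at (Ret T A y) (i + m) k = word_at (Ret T A x) i k.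
Proof.
move=> clA dy; have := Ret_nbhs T x i k clA; rewrite nbhsE => -[U [oU Ux] UP].
have [|t [Ut [m _ e]]] := dy U _ oU; first by exists x.
by move: Ut; rewrite -e => /UP /=; rewrite word_at_Ret_zpow; exists m.
Qed.

Lemma subword_of_window V (y : bin_seq) a (n l k : nat) :
    subword_of V (word_at y a n) -> (l + k <= n)%N ->
  subword_of V (word_at y (a + l%:Z) k).
Proof.
move=> [p]; rewrite size_word_at => e lk; exists (p + l)%N; rewrite size_word_at.
apply: (@eq_from_nth _ true); rewrite size_word_at ?size_mkseq // => j jk.
rewrite !nth_mkseq //; have jn : (l + j < n)%N by lia.
have := congr1 (nth true ^~ (l + j)%N) e; rewrite /= !nth_mkseq // addnA => <-.
by congr y; lia.
Qed.

(* Minimality and compactness bound the gaps between the occurrences of a given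
   word, so every long enough subword of V contains it. *)
Lemma minimal_windows (R : realType) (X : metricType R) (T : homeo X X) (x0 : X)
    (hT : minimal_cantor_system T) (A : set X) (V : nat -> bool) :
    clopen A ->
    (forall N : nat, exists a (n : nat),
      (N <= n)%N /\ subword_of V (word_at (Ret T A x0) a n)) ->
  forall x, rank1_subshift V (Ret T A x).
Proof.
move=> clA long; have [[_ cX _ _] dT] := hT.
have V0 i k : subword_of V (word_at (Ret T A x0) i k).
  set p := word_at _ i k.
  have [N NP] : exists N : nat, forall x, exists2 m : int,
      (`|m| <= N)%N & word_at (Ret T A x) (i + m) k = p.
    apply: contrapT => noN.
    have /choice[u uP] : forall N : nat, exists x, forall m : int,
        (`|m| <= N)%N -> word_at (Ret T A x) (i + m) k <> p.
      move=> N; apply: contrapT => nox; apply: noN; exists N => x.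
      apply: contrapT => nom; apply: nox; exists x => m mN e.
      by apply: nom; exists m.
    have [x xP] := compact_seq_cluster u cX.
    have [m xm] := dense_orbit_window x0 i k clA (dT x).
    have [n mn /= e] := xP _ (Ret_nbhs T x (i + m) k clA) `|m|%N.
    by apply: (uP n m mn); rewrite e.
  have [a [n [Nn Vn]]] := long (N + N + k)%N.
  (* Centring at [a + N - i] puts the occurrence at position [a + N + m]; as |m| is at most N, it
     lies in the window of length at least 2N + k starting at [a]. *)
  have [m mN <-] := NP (zpow T (a + N%:Z - i) x0).
  rewrite word_at_Ret_zpow.
  have -> : i + m + (a + N%:Z - i) = a + (absz (N%:Z + m)%R)%:Z by lia.
  by apply: subword_of_window Vn _; lia.
move=> x i k; have [m <-] := dense_orbit_window x i k clA (dT x0).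
exact: V0.
Qed.

Lemma bin_seq_cvg (F : set_system bin_seq) (y : bin_seq) : Filter F ->
  (forall i, F [set g | g i = y i]) -> F --> y.
Proof.
move=> FF Fy; apply/cvg_sup => i B [_ [[C oC <-] Cy sCB]].
apply: filterS sCB _; apply: filterS (Fy i) => g /= gi.
by rewrite /preimage /= /proj gi.
Qed.

Lemma bin_subset_hausdorff (S : set bin_seq) : hausdorff_space S.
Proof.
move=> y y' cl; apply: val_inj; apply/funext => i.
have nb (t : S) : nbhs t [set u : S | set_val u i = set_val t i].
  by have [oU _] := coordinate_clopen S i (set_val t i); exact: open_nbhs_nbhs.
have [u [/= e1 e2]] := cl _ _ (nb y) (nb y').
exact: etrans (esym e1) e2.
Qed.

Lemma continuous_bijection_homeo (X Y : topologicalType) (f : X -> Y) (g : Y -> X) :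
    compact [set: X] -> hausdorff_space Y -> continuous f ->
    cancel f g -> cancel g f -> continuous g.
Proof.
move=> cX hY cf fK gK; apply/continuous_closedP => C cC.
have -> : g @^-1` C = f @` C.
  apply/seteqP; split=> [y Cy|_ [x Cx <-]]; last by rewrite /= fK.
  by exists (g y).
apply: (compact_closed hY); apply: continuous_compact.
  exact: continuous_subspaceT.
by have := compact_closedI cX cC; rewrite setTI.
Qed.

(** [Ret T A] is injective because [A] generates, and maps into the subshift by [minimal_windows].
    It is onto by compactness, and a continuous bijection from a compact space to a Hausdorff space
    is a homeomorphism. *)
Lemma generating_conjugate (R : realType) (X : metricType R) (T : homeo X X)
    (x0 : X) (hT : minimal_cantor_system T) (A : set X) (V : nat -> bool) :
    clopen A -> generating T A ->
    (forall w, subword_of V w -> exists a, word_at (Ret T A x0) a (size w) = w) ->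
    (forall N : nat, exists a (n : nat),
      (N <= n)%N /\ subword_of V (word_at (Ret T A x0) a n)) ->
  infinite_set (rank1_subshift V) /\ conjugate T (@rank1_shift V).
Proof.
move=> clA gen occ long; have [[_ cX _ zX] dT] := hT.
have RV := minimal_windows hT clA long.
have Rinj := generating_Ret_inj zX gen.
split.
  move=> finV; apply: (minimal_cantor_infinite x0 hT).
  rewrite (_ : [set: X] = Ret T A @^-1` rank1_subshift V).
    by apply: finite_preimage finV => x y _ _; exact: Rinj.
  by apply/seteqP; split=> // x _; exact: RV.
pose f x : rank1_subshift V := exist _ (Ret T A x) (mem_set (RV x)).
have valf x : set_val (f x) = Ret T A x by [].
have /choice[g gP] : forall y : rank1_subshift V, exists x, f x = y.
  (* Points on the orbit of [x0] realize ever larger central windows of [y]; a cluster point of them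
     is a preimage of [y]. *)
  move=> y; have /choice[u uP] : forall N : nat, exists x, forall i : int,
      (`|i| <= N)%N -> Ret T A x i = set_val y i.
    move=> N; have := set_valP y (- N%:Z) (N + N).+1.
    move=> /occ[a]; rewrite size_word_at => /eq_word_at aP.
    exists (zpow T (a + N%:Z) x0) => i iN; rewrite Ret_zpow.
    have e : - N%:Z + (i + N%:Z) = i by lia.
    rewrite -[in RHS]e; apply: etrans (aP (i + N%:Z) _ _); [|lia|lia].
    by congr (Ret T A x0 _); lia.
  have [x xP] := compact_seq_cluster u cX; exists x; apply: val_inj.
  rewrite -[val _]/(Ret T A x) -[val y]/(set_val y); apply/funext => i.
  have [n ni /= e] := xP _ (Ret_nbhs T x i 1 clA) `|i|%N.
  rewrite -(uP n i ni).
  by move/eq_word_at: e => /(_ 0); rewrite !addr0 => ->.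
have fK : cancel f g.
  by move=> x; apply: Rinj; rewrite -!valf gP.
have cf : continuous f.
  move=> x B [_ [[C oC <-] Cfx sCB]].
  have cR : Ret T A t @[t --> x] --> (Ret T A x : bin_seq).
    apply: bin_seq_cvg => i; apply: filterS (Ret_nbhs T x i 1 clA) => t /= e.
    by move/eq_word_at: e => /(_ 0); rewrite !addr0; exact.
  have : nbhs (Ret T A x : bin_seq) C by exact: open_nbhs_nbhs.
  move=> /cR CR; have nC : nbhs x [set t | C (Ret T A t)] by exact: CR.
  by apply: filterS nC => t Ct; exact: sCB.
have cg := continuous_bijection_homeo cX (bin_subset_hausdorff (S := _)) cf fK gP.
exists (Homeo fK gP cf cg) => x /=; apply: val_inj; apply/funext => k /=.
rewrite -[LHS]/(Ret T A (T x) k) -[RHS]/(Ret T A x (k + 1)).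
by rewrite -[T x]/(zpow T 1 x) Ret_zpow.
Qed.

Theorem theorem4p2 (R : realType) (X : metricType R) (T : homeo X X) (x0 : X)
    (hT : minimal_cantor_system T) :
  (exists V : nat -> bool,
     [/\ rank1_word V,
         infinite_set (rank1_subshift V)
       & conjugate T (@rank1_shift V)])
  <->
  (exists A : set X,
     [/\ clopen A,
         generating T A
       & forall n : nat, exists v : seq bool,
           [/\ calF v,
               (n <= size v)%N,
               built_from (Ret T A x0) v
             & forall u : seq bool,
                 calF u -> (size v <= size u)%N -> built_from (Ret T A x0) u ->
                 exists u' : seq bool,
                   [/\ calF u',
                       (size u' <= size u + size v)%N,
                       word_built_from u' v
                     & prefix u u']]]).
Proof.
split=> [[V [rV _ cV]]|[A [clA gen built]]].
  have [A [clA gen ZA aper built]] := rank1_conjugate_generating x0 hT rV cV.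
  have [z zP] := zero_enum_exists ZA.
  exists A; split=> // n; have [v [Fv nv bv]] := built n.
  exists v; split=> // u Fu vu bu.
  exact: (built_from_extend zP aper Fv bv Fu bu vu).
(* By injectivity of [Ret T A], a period of the return sequence would be a period of [x0]. *)
have aper d : 0 < d -> ~ forall m, Ret T A x0 (m + d) = Ret T A x0 m.
  move=> d0 per; apply: (minimal_cantor_aperiodic (x := x0) hT d0).
  have [[_ _ _ zX] _] := hT; apply: (generating_Ret_inj zX gen).
  by apply/funext => m; rewrite Ret_zpow.
have ZA : calZ (Ret T A x0) by have [v [_ _ []]] := built 0%N.
have [z zP] := zero_enum_exists ZA.
have [n|V [rV occ long]] := rank1_word_chain zP aper.
  by have [v [Fv nv bv _]] := built n; exists v.
exists V; have [iV cV] := generating_conjugate hT clA gen occ long.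
by split.
Qed.
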